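(* Let $u\in C([0,T],\mathbb{R}^m)$, $y_{\mathrm{data}}\in C([0,T],\mathbb{R}^m)$, $w_{\mathrm{ref}}\in W$ and $\lambda\ge 0$ be given. Assume that $\lambda > 0$ or that $\mathcal{U}_{\mathrm{ad}}$ is bounded. Then the identification problem $$\min_{(y,w) \in Y \times \mathcal{U}_{\mathrm{ad}} } \ \mathcal{J}(y,w) = \frac{1}{2} \int_0^T |y(t) - y_{\mathrm{data}}(t) |^2\, dt + \frac{\lambda}{2} | w-w_{\mathrm{ref}} |^2$$ subject to, with $w=(J,R,Q,B,x_0)$, $$\frac{d}{dt} x = (J-R) Qx + B u, \quad x(0)=x_0, \qquad y = B^\top Q x,$$ admits a global minimum.
   Context: Let $T>0$ and $n,m\in\mathbb{N}$. The parameter space is $W = \mathbb{R}^{n\times n} \times \mathbb{R}^{n\times n} \times \mathbb{R}^{n\times n} \times \mathbb{R}^{n\times m} \times \mathbb{R}^n$ with its Euclidean norm $|\cdot|$. The set of admissible parameters is a set $$\mathcal{U}_{\mathrm{ad}} \subseteq \{ w = (J,R,Q,B,x_0) \in W : J^\top = -J,\ R \succcurlyeq 0,\ Q \succ 0 \},$$ where $R \succcurlyeq 0$ means symmetric positive semidefinite and $Q\succ 0$ means symmetric positive definite. The output space is $Y=H^1((0,T),\mathbb{R}^m)$. Here $u$ is the given input, $y_{\mathrm{data}}$ the given output data and $w_{\mathrm{ref}}$ a given reference value for the parameters.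
   Formalization: The set of admissible parameters U_ad is additionally assumed to be nonempty and closed in W; without this the claim fails, e.g. for U_ad = {(0,0,q,0,0) : q > 0} with u = y_data = 0, w_ref = 0, λ = 1, where the infimum 0 is not attained. *)

(* Defs.v *)
From HB Require Import structures.
From mathcomp Require Import all_boot all_order all_algebra.
From mathcomp Require Import all_classical all_reals all_analysis.
Import Order.TTheory GRing.Theory Num.Theory.
Import numFieldNormedType.Exports.

Set Implicit Arguments.
Unset Strict Implicit.
Unset Printing Implicit Defensive.

Local Open Scope classical_set_scope.
Local Open Scope ring_scope.

(* The library's norm on matrices is the maximum norm, so the Euclidean
   (Frobenius) one is introduced separately. *)
Definition euclidean_norm (R : realType) (p q : nat) (A : 'M[R]_(p, q)) : R :=
  Num.sqrt (\sum_(i < p) \sum_(j < q) A i j ^+ 2).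

Definition psd (R : realType) (n : nat) (A : 'M[R]_n) : Prop :=
  A^T = A /\ forall v : 'cV[R]_n, 0 <= (v^T *m A *m v) 0 0.

Definition pd (R : realType) (n : nat) (A : 'M[R]_n) : Prop :=
  A^T = A /\ forall v : 'cV[R]_n, v != 0 -> 0 < (v^T *m A *m v) 0 0.

(* Quintuples (J, D, Q, B, x0), where D is the dissipation matrix, usually
   written R.  Closedness of a set of parameters refers to the library's product
   topology, which is the topology induced by [param_norm]. *)
Definition param (R : realType) (n m : nat) : Type :=
  ('M[R]_n * 'M[R]_n * 'M[R]_n * 'M[R]_(n, m) * 'cV[R]_n)%type.

Definition param_norm (R : realType) (n m : nat) (w : param R n m) : R :=
  let: (J, D, Q, B, x0) := w in
  Num.sqrt (euclidean_norm J ^+ 2 + euclidean_norm D ^+ 2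
    + euclidean_norm Q ^+ 2 + euclidean_norm B ^+ 2 + euclidean_norm x0 ^+ 2).

Definition structured (R : realType) (n m : nat) : set (param R n m) :=
  [set w | let: (J, D, Q, B, x0) := w in [/\ J^T = - J, psd D & pd Q]].

Definition square_integrable (R : realType) (T : R) (f : R -> R) : Prop :=
  measurable_fun `]0, T[ f /\
  (@lebesgue_measure R).-integrable `]0, T[ (fun t => (f t ^+ 2)%:E).

Definition test_function (R : realType) (T : R) (phi : R -> R) : Prop :=
  [/\ forall (k : nat) (t : R), derivable (derive1n k phi) t 1,
      compact (closure [set t | phi t != 0])
    & closure [set t | phi t != 0] `<=` `]0, T[ ].

Definition weak_derivative (R : realType) (T : R) (f g : R -> R) : Prop :=
  forall phi : R -> R, test_function T phi ->
    \int[lebesgue_measure]_(t in `]0, T[) (f t * derive1 phi t) =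
    - \int[lebesgue_measure]_(t in `]0, T[) (g t * phi t).

(* Elements of H^1((0,T), R^m) are represented by functions on the whole line,
   of which only the restriction to (0,T), up to null sets, is meaningful. *)
Definition sobolev_H1 (R : realType) (m : nat) (T : R)
    (y : R -> 'cV[R]_m) : Prop :=
  forall i : 'I_m, square_integrable T (fun t => y t i 0) /\
    exists2 g : R -> R, square_integrable T g
      & weak_derivative T (fun t => y t i 0) g.

(* As the input is continuous, the state is a classical solution: continuous
   on [0,T], with the differential equation holding at every interior time. *)
Definition state_solution (R : realType) (n m : nat) (T : R)
    (u : R -> 'cV[R]_m) (w : param R n m) (x : R -> 'cV[R]_n) : Prop :=
  let: (J, D, Q, B, x0) := w in
  [/\ {within `[0, T], continuous x},
      forall t : R, t \in `]0, T[ ->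
        is_derive t 1 x ((J - D) *m Q *m x t + B *m u t)
    & x 0 = x0].

(* The output equation is an identity in H^1((0,T), R^m), hence holds almost
   everywhere for the chosen representative. *)
Definition output_equation (R : realType) (n m : nat) (T : R)
    (w : param R n m) (x : R -> 'cV[R]_n) (y : R -> 'cV[R]_m) : Prop :=
  let: (J, D, Q, B, x0) := w in
  {ae @lebesgue_measure R, forall t, t \in `]0, T[ -> y t = B^T *m Q *m x t}.

Definition feasible (R : realType) (n m : nat) (T : R)
    (Uad : set (param R n m)) (u : R -> 'cV[R]_m) :
    set ((R -> 'cV[R]_m) * param R n m) :=
  [set yw | [/\ sobolev_H1 T yw.1, Uad yw.2
    & exists2 x : R -> 'cV[R]_n, state_solution T u yw.2 x
        & output_equation T yw.2 x yw.1]].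

Definition cost (R : realType) (n m : nat) (T : R) (ydata : R -> 'cV[R]_m)
    (wref : param R n m) (lambda : R)
    (yw : (R -> 'cV[R]_m) * param R n m) : R :=
  2^-1 * \int[lebesgue_measure]_(t in `[0, T])
           (euclidean_norm (yw.1 t - ydata t) ^+ 2)
  + lambda / 2 * param_norm (yw.2 - wref) ^+ 2.

(* Main.v *)
(* By variation of constants the state exists for every w, and by Gronwall's
   inequality it is unique and, on [0, T], depends on w continuously in the
   uniform norm.  The output of a feasible pair is thus determined almost
   everywhere by w, and the problem reduces to minimizing a continuous function
   of w over the closed set of admissible parameters; the assumption on lambda
   or on this set makes some nonempty sublevel set bounded, hence compact. *)
Require Import Defs.
From HB Require Import structures.
From mathcomp Require Import all_boot all_order all_algebra.
From mathcomp Require Import all_classical all_reals all_analysis.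
From mathcomp Require Import measurable_realfun ring lra.
Import Order.TTheory GRing.Theory Num.Theory.
Import numFieldNormedType.Exports.

Set Implicit Arguments.
Unset Strict Implicit.
Unset Printing Implicit Defensive.

Local Open Scope classical_set_scope.
Local Open Scope ring_scope.

(** A feasible state solves its equation only inside []0, T[], and a feasible output is fixed only
    up to null sets. So each parameter receives one canonical state, which solves an extended
    equation on a half-line around [[0, T]]. Its output is shown to be feasible, and any competing
    pair is shown to cost the same as the canonical output of its own parameter. The canonical
    states are picked by choice, without any regularity in [w]; continuity of the cost comes from
    the stability estimate alone.

    Subtracting the equations of two parameters leaves a linear equation with a small residual, so a
    single Gronwall estimate, for the sum of squared entries, yields both stability and uniqueness.
    Limits are taken along filters, so that the neighbourhoods of a parameter can be used directly.
    Bounds are kept entry by entry, since the parameter space carries a product topology in which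
    boxes are visibly compact. *)

Lemma is_derive_mxP (R : realType) (p q : nat) (F : R -> 'M[R]_(p, q)) (t : R)
    (dF : 'M[R]_(p, q)) :
  is_derive t 1 F dF <->
  forall i j, is_derive t 1 (fun s => F s i j) (dF i j).
Proof.
split=> [[dvF <-] i j|dvF].
  split; first by move/derivable_mxP: dvF.
  by rewrite derive_mx// mxE.
have dvb : derivable F t 1 by apply/derivable_mxP => i j; case: (dvF i j).
split=> //; rewrite derive_mx//; apply/matrixP => i j; rewrite mxE.
by case: (dvF i j).
Qed.

Lemma cvg_sumr (R : realType) (I T : Type) (F : set_system T)
    (FF : Filter F) (r : seq I) (f : I -> T -> R) (l : I -> R) :
  (forall i, f i x @[x --> F] --> l i) ->
  \sum_(i <- r) f i x @[x --> F] --> \sum_(i <- r) l i.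
Proof. by move=> fl; apply: cvg_big => //; exact: add_continuous. Qed.

Lemma is_derive_mulmx (R : realType) (p q r : nat) (F : R -> 'M[R]_(p, q))
    (G : R -> 'M[R]_(q, r)) (t : R) (dF : 'M[R]_(p, q)) (dG : 'M[R]_(q, r)) :
  is_derive t 1 F dF -> is_derive t 1 G dG ->
  is_derive t 1 (fun s => F s *m G s) (dF *m G t + F t *m dG).
Proof.
move=> /is_derive_mxP hF /is_derive_mxP hG; apply/is_derive_mxP => i j.
rewrite [X in is_derive _ _ X _](_ : _ = \sum_(l < q) ((fun s => F s i l) * (fun s => G s l j))); last first.
  by apply/funext => s; rewrite mxE fct_sumE.
apply: is_derive_eq (is_derive_sum (fun l => is_deriveM (hF i l) (hG l j))) _.
rewrite [RHS]mxE ![in RHS]mxE -big_split/=.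
by apply: eq_bigr => l _; rewrite [RHS]addrC [X in _ = _ + X]mulrC.
Qed.

(** * The matrix exponential as a power series in each entry *)

Section MatrixExponential.
Variables (R : realType) (n : nat) (A : 'M[R]_n).
Implicit Types (M : 'M[R]_n) (t : R).

(** Coefficients of the entries of [M e^(tA)]. Carrying the left factor [M] closes the family under
    termwise differentiation, which only replaces [M] by [M *m A]; the exponential is the case
    [M = 1]. *)
Let coef M i j (k : nat) : R := (M *m A ^+ k) i j * (k`!%:R)^-1.

Let powE M (k : nat) : M *m A ^+ k.+1 = (M *m A ^+ k) *m A.
Proof. by rewrite exprSr mulmxA. Qed.

Let pow_bound M : exists B C : R, forall (k : nat) i j,
  `|(M *m A ^+ k) i j| <= B * C ^+ k.
Proof.
have bnd (N : 'M[R]_n) : exists2 b, 0 <= b & forall i j, `|N i j| <= b.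
  exists (\sum_i \sum_j `|N i j|).
    by apply: sumr_ge0 => i _; exact: sumr_ge0.
  move=> i j; rewrite (bigD1 i)//= (bigD1 j)//= -addrA lerDl addr_ge0//.
    exact: sumr_ge0.
  by apply: sumr_ge0 => k _; exact: sumr_ge0.
have [B B0 HB] := bnd M; have [a a0 Ha] := bnd A.
(* Each further factor [A] turns an entry into a sum of [n] terms, each at most [a] times the
   previous bound. *)
exists B, (n%:R * a); elim=> [i j|k IH i j].
  by rewrite !expr0 mulr1 mulmx1.
rewrite powE mxE (le_trans (ler_norm_sum _ _ _))//.
apply: (@le_trans _ _ (\sum_(l < n) B * (n%:R * a) ^+ k * a)).
  by apply: ler_sum => l _; rewrite normrM ler_pM.
by rewrite sumr_const card_ord -mulr_natl exprS; lra.
Qed.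

Let coef_cvg M i j t : cvgn (pseries (coef M i j) t).
Proof.
have [B [C BC]] := pow_bound M.
have bnd k : `|coef M i j k * t ^+ k| <= B * exp_coeff (`|C * t|) k.
  rewrite /coef /exp_coeff /= !normrM.
  have f0 : 0 <= (k`!%:R)^-1 :> R by rewrite invr_ge0 ler0n.
  rewrite (ger0_norm f0) mulrAC mulrA ler_wpM2r// exprMn mulrA -!normrX.
  rewrite ler_wpM2r//.
  rewrite (le_trans (BC k i j))//.
  have B0 : 0 <= B by have := le_trans (normr_ge0 _) (BC 0%N i j); rewrite expr0 mulr1.
  by rewrite ler_wpM2l// ler_norm.
apply: normed_cvg.
apply: (series_le_cvg _ _ bnd) => //.
  by move=> k /=; apply: le_trans (bnd k).
exact: (is_cvg_seriesZ (k := B) (is_cvg_series_exp_coeff `|C * t|)).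
Qed.

Let coef_diffs M i j : pseries_diffs (coef M i j) = coef (M *m A) i j.
Proof.
apply/funext => k; rewrite /pseries_diffs /coef exprS -mulmxE mulmxA factS natrM.
by rewrite invfM mulrCA mulVKf.
Qed.

Let S M t := \matrix_(i, j) limn (pseries (coef M i j) t).

Let S_derive M t : is_derive t 1 (S M) (S (M *m A) t).
Proof.
apply/is_derive_mxP => i j.
rewrite [X in is_derive _ _ X _](_ : _ = fun s => limn (pseries (coef M i j) s)); last first.
  by apply/funext => s; rewrite mxE.
rewrite mxE -coef_diffs.
(* Termwise differentiation at [t] asks for convergence at a point of larger modulus; the series
   converges everywhere, so [|t| + 1] serves. *)
apply: (@pseries_snd_diffs _ _ (`|t| + 1)); rewrite ?coef_diffs//.
by rewrite (ger0_norm (addr_ge0 _ _))// ltrDl.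
Qed.

Let S_mull M N t : S (M *m N) t = M *m S N t.
Proof.
apply/matrixP => i j; rewrite !mxE.
apply/cvg_lim => //.
rewrite (_ : pseries _ t = fun k => \sum_(l < n) M i l * pseries (coef N l j) t k); last first.
  apply/funext => k; rewrite /pseries /series/=.
  under [RHS]eq_bigr do rewrite mulr_sumr.
  rewrite exchange_big/=; apply: eq_bigr => l _.
  rewrite /coef -mulmxA [in LHS]mxE 2!mulr_suml; apply: eq_bigr => r _.
  by rewrite !mulrA.
under eq_bigr do rewrite mxE.
by apply: cvg_sumr => l; apply: cvgMl_tmp; exact: coef_cvg.
Qed.

(** Powers of [A] commute with [A], so the factor may also leave on the right. This makes the two
    terms in the derivative of [E t *m E (- t)] cancel. *)
Let S_mulr t : S A t = S 1%:M t *m A.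
Proof.
apply/matrixP => i j; rewrite !mxE.
apply/cvg_lim => //.
rewrite (_ : pseries _ t =
    fun k => \sum_(l < n) pseries (coef 1%:M i l) t k * A l j); last first.
  apply/funext => k; rewrite /pseries /series/=.
  under [RHS]eq_bigr do rewrite mulr_suml.
  rewrite exchange_big/=; apply: eq_bigr => l _.
  have Al : A *m A ^+ l = A ^+ l *m A by rewrite mulmxE -exprS exprSr.
  rewrite /coef Al [in LHS]mxE.
  rewrite 2!mulr_suml; apply: eq_bigr => r _.
  by rewrite mul1mx; ring.
under eq_bigr do rewrite mxE.
by apply: cvg_sumr => l; apply: cvgMr_tmp; exact: coef_cvg.
Qed.

Let S0 : S 1%:M 0 = 1%:M.
Proof.
apply/matrixP => i j; rewrite mxE.
apply: lim_near_cst => //.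
near=> k; rewrite -[k]prednK; last by near: k.
rewrite /pseries /series/= big_nat_recl//= big1 ?addr0.
  by rewrite /coef !expr0 mulmx1 fact0 invr1 !mulr1.
by move=> l _; rewrite exprS mul0r mulr0.
Unshelve. all: by end_near. Qed.

Lemma matrix_exponential : exists E : R -> 'M[R]_n,
  [/\ E 0 = 1%:M, forall t, is_derive t 1 E (A *m E t)
    & forall t, E t *m E (- t) = 1%:M].
Proof.
exists (S 1%:M); split=> // [t|t].
  by apply: is_derive_eq (S_derive 1%:M t) _; rewrite mul1mx -S_mull mulmx1.
have dN (s : R) : is_derive s 1 (fun s : R => S 1%:M (- s)) (- (A *m S 1%:M (- s))).
  apply/is_derive_mxP => i j.
  have /is_derive_mxP/(_ i j) d1 := S_derive 1%:M (- s).
  have := is_derive1_comp d1 (is_deriveN (is_derive_id s 1)).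
  move=> d2; apply: is_derive_eq d2 _.
  by rewrite mul1mx -S_mull mulmx1 [RHS]mxE mulrN1.
(* Invertibility without the addition law: the product has zero derivative, so it keeps its value at
   [0]. *)
have dP (s : R) : is_derive s 1 (fun s : R => S 1%:M s *m S 1%:M (- s)) 0.
  apply: is_derive_eq (is_derive_mulmx (S_derive 1%:M s) (dN s)) _.
  by rewrite mul1mx S_mulr mulmxN mulmxA subrr.
apply/matrixP => i j.
transitivity ((S 1%:M 0 *m S 1%:M (- 0)) i j); last first.
  by rewrite oppr0 S0 mulmx1.
apply: (@is_derive_0_is_cst _ (fun s => (S 1%:M s *m S 1%:M (- s)) i j)) => s.
by have /is_derive_mxP/(_ i j) := dP s; rewrite mxE.
Qed.

End MatrixExponential.

(** * Antiderivatives and variation of constants *)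

Lemma is_derive_continuous (R : realType) (f : R -> R) (t df : R) :
  is_derive t 1 f df -> {for t, continuous f}.
Proof.
by case=> dvf _; apply/differentiable_continuous/derivable1_diffP.
Qed.

(** Integrating from [-1] makes the initial time [0] an interior point, where the derivative is
    two-sided; subtracting the value at [0] restores the normalisation. *)
Lemma continuous_antiderivative (R : realType) (f : R -> R) :
  continuous f ->
  exists2 F : R -> R, F 0 = 0 & forall t : R, - 1 < t -> is_derive t 1 F (f t).
Proof.
move=> cf.
pose F y := \int[lebesgue_measure]_(s in `[-1, y]) f s.
exists (fun y => F y - F 0); first by rewrite subrr.
move=> t t1.
have int1 : (@lebesgue_measure R).-integrable `[-1, t + 1] (EFin \o f).
  apply: continuous_compact_integrable; first exact: segment_compact.
  exact: continuous_subspaceT.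
have [|dF <-] := continuous_FTC1_closed _ int1 t1 (cf t).
  by rewrite ltrDl.
rewrite derive1E.
have dF' : is_derive t 1 F ('D_1 F t) by split.
have := is_deriveB dF' (is_derive_cst (F 0) t 1).
by rewrite subr0.
Qed.

Lemma linear_ode_solution (R : realType) (n : nat) (A : 'M[R]_n)
    (b : R -> 'cV[R]_n) (x0 : 'cV[R]_n) :
  (forall i, continuous (fun t => b t i 0)) ->
  exists2 x : R -> 'cV[R]_n, x 0 = x0
    & forall t : R, - 1 < t -> is_derive t 1 x (A *m x t + b t).
Proof.
move=> cb; have [E [E0 dE EK]] := matrix_exponential A.
have cE i j : continuous (fun t => E t i j).
  by move=> t; have /is_derive_mxP/(_ i j)/is_derive_continuous := dE t.
(* The integrand of [x t = E t (x0 + int_0^t E (- s) b s ds)], integrated one coordinate at a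
   time. *)
pose f i s := (E (- s) *m b s) i 0.
have cf i : continuous (f i).
  have -> : f i = fun s => \sum_j E (- s) i j * b s j 0.
    by apply/funext => s; rewrite /f mxE.
  move=> s; apply: cvg_sumr => j; apply: cvgM; last exact: cb.
  apply: (@continuous_comp _ _ _ (fun s : R => - s) (fun s => E s i j)).
    exact: opp_continuous.
  exact: cE.
have /choice[F HF] (i : 'I_n) : exists Fi : R -> R,
    Fi 0 = 0 /\ forall t : R, - 1 < t -> is_derive t 1 Fi (f i t).
  by have [Fi ? ?] := continuous_antiderivative (cf i); exists Fi.
pose y t : 'cV[R]_n := x0 + \col_i F i t.
exists (fun t => E t *m y t).
  rewrite E0 mul1mx /y [X in _ + X](_ : _ = 0) ?addr0//.
  by apply/matrixP => i j; rewrite !mxE (HF i).1.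
move=> t t1.
have dy : is_derive t 1 y (E (- t) *m b t).
  apply/is_derive_mxP => i j; rewrite ord1.
  have -> : (fun s => y s i 0) = cst (x0 i 0) + F i.
    by apply/funext => s; rewrite /y !mxE.
  apply: is_derive_eq (is_deriveD (is_derive_cst _ _ _) ((HF i).2 t t1)) _.
  by rewrite add0r.
apply: is_derive_eq (is_derive_mulmx (dE t) dy) _.
by rewrite mulmxA EK mul1mx mulmxA.
Qed.

(** * Gronwall's inequality and the a priori estimate *)

Lemma gronwall (R : realType) (g dg : R -> R) (T K c : R) :
  0 <= K -> 0 <= c -> 0 <= g 0 -> {within `[0, T], continuous g} ->
  (forall t, t \in `]0, T[ -> is_derive t 1 g (dg t)) ->
  (forall t, t \in `]0, T[ -> dg t <= K * g t + c) ->
  forall t, t \in `[0, T] -> g t <= expR (K * T) * (g 0 + c * T).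
Proof.
move=> K0 c0 g0 cg dvg dgle t tT.
(* [h] is nonincreasing: its derivative is at most [c * expR (- K * s) - c], which is nonpositive
   because [K] and [c] are nonnegative. *)
pose h s := g s * expR (- K * s) - c * s.
have dE (s : R) : is_derive s 1 (fun s => expR (- K * s)) (- K * expR (- K * s)).
  have d1 : is_derive s 1 (fun s : R => - K * s) (- K).
    have := is_deriveZ (- K) (is_derive_id s (1 : R)).
    by rewrite /GRing.scale/= mulr1.
  have := is_derive1_comp (is_derive_expR (- K * s)) d1.
  by rewrite mulrC.
have dh (s : R) : s \in `]0, T[ ->
    is_derive s 1 h ((dg s - K * g s) * expR (- K * s) - c).
  move=> sT.
  have d2 : is_derive s 1 (fun s : R => c * s) c.
    have := is_deriveZ c (is_derive_id s (1 : R)).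
    by rewrite /GRing.scale/= mulr1.
  apply: is_derive_eq (is_deriveB (is_deriveM (dvg s sT) (dE s)) d2) _.
  by rewrite /GRing.scale/=; ring.
have ch : {within `[0, T], continuous h}.
  apply: within_continuousB.
    move=> s; apply: cvgM; first exact: cg.
    move: s; apply: continuous_subspaceT => s.
    exact: is_derive_continuous (dE s).
  by apply: continuous_subspaceT => s; apply: mulrl_continuous.
have ht : h t <= h 0.
  apply: (@ler0_derive1_le_cc _ h 0 T) => //.
  - by move=> s /dh [].
  - move=> s sT; rewrite derive1E; have [_ ->] := dh s sT.
    have E1 : expR (- K * s) <= 1.
      rewrite -expR0 ler_expR mulNr oppr_le0 mulr_ge0//.
      by move: sT; rewrite in_itv/= => /andP[/ltW].
    have E0 := expR_gt0 (- K * s).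
    rewrite subr_le0 (le_trans _ (ler_piMr c0 E1))// ler_pM2r//.
    by rewrite lerBlDl dgle.
  - by move: tT; rewrite !in_itv/= lexx => /andP[+ +]; exact: le_trans.
  - by move: tT; rewrite in_itv/= => /andP[].
move: ht; rewrite /h !mulr0 expR0 mulr1 subr0 lerBlDr mulNr expRN.
rewrite ler_pdivrMr ?expR_gt0// => /le_trans; apply.
move: tT; rewrite in_itv/= => /andP[t0 tT].
rewrite mulrC ler_pM ?expR_ge0 ?addr_ge0 ?mulr_ge0//.
  by rewrite ler_expR ler_wpM2l.
by rewrite lerD2l ler_wpM2l.
Qed.

(** Gronwall for the sum of squares, which, unlike a norm, is differentiable where it vanishes. In
    the rate, [2 * n%:R * M] comes from the matrix and [1] from splitting the product of [d] and
    [e]. *)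
Lemma linear_ode_estimate (R : realType) (n : nat) (A : 'M[R]_n)
    (d e : R -> 'cV[R]_n) (T M eps : R) :
  0 <= M -> (forall i j, `|A i j| <= M) ->
  (forall i, {within `[0, T], continuous (fun t => d t i 0)}) ->
  (forall t : R, t \in `]0, T[ -> is_derive t 1 d (A *m d t + e t)) ->
  (forall t i, t \in `]0, T[ -> `|e t i 0| <= eps) ->
  forall t i, t \in `[0, T] ->
    `|d t i 0| ^+ 2 <= expR ((2 * n%:R * M + 1) * T) *
      (\sum_j d 0 j 0 ^+ 2 + n%:R * eps ^+ 2 * T).
Proof.
move=> M0 AM cd dvd ele t i tT.
pose g (s : R) := \sum_j d s j 0 ^+ 2.
pose dg (s : R) := \sum_j (2 * d s j 0 * (A *m d s + e s) j 0).
apply: (@le_trans _ _ (g t)).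
  rewrite real_normK ?num_real// /g (bigD1 i)//= lerDl.
  by apply: sumr_ge0 => j _; exact: sqr_ge0.
apply: (@gronwall _ g dg T) => //.
- by rewrite addr_ge0// !mulr_ge0.
- by rewrite mulr_ge0// sqr_ge0.
- by apply: sumr_ge0 => j _; exact: sqr_ge0.
- move=> s; apply: cvg_sumr => j.
  by apply: cvgM; exact: cd.
- move=> s sT; have /is_derive_mxP dvs := dvd s sT.
  rewrite [X in is_derive _ _ X _](_ : _ =
      \sum_(j < n) (fun s => d s j 0) * (fun s => d s j 0)); last first.
    by apply/funext => r; rewrite /g fct_sumE; apply: eq_bigr => j _.
  apply: is_derive_eq
    (is_derive_sum (fun j => is_deriveM (dvs j 0) (dvs j 0))) _.
  apply: eq_bigr => j _; rewrite /GRing.scale/= -mulr2n -mulrA mulr_natl//.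
- move=> s sT.
  apply: (@le_trans _ _ (\sum_j (\sum_k M * (d s j 0 ^+ 2 + d s k 0 ^+ 2)
      + (d s j 0 ^+ 2 + eps ^+ 2)))).
    apply: ler_sum => j _.
    rewrite mxE mulrDr lerD//.
      rewrite mxE mulr_sumr ler_sum// => k _.
      have := AM j k; move: (A j k) (d s j 0) (d s k 0) => a x y.
      rewrite ler_norml => /andP[a1 a2].
      (* Adding [h1] and [h2] gives [2 a x y <= M (x^2 + y^2)] whatever the sign of [a]. *)
      have h1 : 0 <= (M + a) * (x - y) ^+ 2.
        by rewrite mulr_ge0 ?sqr_ge0// -lerBlDl sub0r.
      have h2 : 0 <= (M - a) * (x + y) ^+ 2.
        by rewrite mulr_ge0 ?sqr_ge0// subr_ge0.
      by lra.
    have := ele s j sT; move: (d s j 0) (e s j 0) => x y.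
    move=> yeps; have h1 : y ^+ 2 <= eps ^+ 2.
      by rewrite -real_normK ?num_real// lerXn2r// nnegrE (le_trans _ yeps).
    have h2 : 0 <= (x - y) ^+ 2 := sqr_ge0 _.
    by lra.
  have sum_cst (x : R) : \sum_(j < n) x = n%:R * x.
    by rewrite sumr_const card_ord mulr_natl.
  rewrite big_split/= [X in _ + X]big_split/= sum_cst -/(g s).
  under eq_bigr do rewrite -mulr_sumr big_split/= sum_cst -/(g s).
  rewrite -mulr_sumr big_split/= sum_cst -mulr_sumr -/(g s).
  by rewrite le_eqVlt; apply/orP; left; apply/eqP; ring.
Qed.

(** * Uniform convergence along a filter and passage to the limit in integrals *)

Section UniformConvergence.
Variables (R : realType) (T : Type) (D : set T) (P : Type) (F : set_system P).
Context {FF : Filter F}.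
Implicit Types (f : P -> T -> R) (g : T -> R).

(* The limit is required to be bounded so that products converge as well. *)
Definition bounded_ucvg f g : Prop :=
  (exists G, forall t, D t -> `|g t| <= G) /\
  forall e, 0 < e -> \forall p \near F, forall t, D t -> `|f p t - g t| <= e.

Lemma bounded_ucvg_fixed g G :
  (forall t, D t -> `|g t| <= G) -> bounded_ucvg (fun=> g) g.
Proof.
move=> gG; split; first by exists G.
by move=> e e0; near=> p => t _; rewrite subrr normr0 ltW.
Unshelve. all: by end_near. Qed.

Lemma bounded_ucvg_scalar (a : P -> R) (l : R) :
  a p @[p --> F] --> l -> bounded_ucvg (fun p => cst (a p)) (cst l).
Proof.
move=> al; split; first by exists `|l|.
move=> e e0; near=> p => t _ /=; rewrite distrC.
by near: p; move/cvgrPdist_le : al; exact.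
Unshelve. all: by end_near. Qed.

Lemma bounded_ucvgD f1 g1 f2 g2 : bounded_ucvg f1 g1 -> bounded_ucvg f2 g2 ->
  bounded_ucvg (fun p t => f1 p t + f2 p t) (fun t => g1 t + g2 t).
Proof.
move=> [[G1 G1P] h1] [[G2 G2P] h2]; split.
  exists (G1 + G2) => t Dt.
  by rewrite (le_trans (ler_normD _ _))// lerD ?G1P ?G2P.
move=> e e0; have e20 : 0 < e / 2 by rewrite divr_gt0.
near=> p => t Dt; rewrite opprD addrACA (le_trans (ler_normD _ _))// (splitr e).
rewrite lerD//.
  by move: t Dt; near: p; exact: h1.
by move: t Dt; near: p; exact: h2.
Unshelve. all: by end_near. Qed.

Lemma bounded_ucvgM f1 g1 f2 g2 : bounded_ucvg f1 g1 -> bounded_ucvg f2 g2 ->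
  bounded_ucvg (fun p t => f1 p t * f2 p t) (fun t => g1 t * g2 t).
Proof.
move=> [[G1 G1P] h1] [[G2 G2P] h2]; split.
  exists (G1 * G2) => t Dt.
  by rewrite normrM ler_pM// ?G1P ?G2P.
(* Absolute values are taken because [G1] and [G2] may be negative when [D] is empty. As [d <= 1],
   the quadratic error [d * d] is at most [d], and the three errors add up to at most [d * K]. *)
move=> e e0; pose K := 1 + `|G1| + `|G2|.
have K0 : 0 < K by rewrite /K -addrA ltr_pwDl// addr_ge0.
pose d := Num.min 1 (e / K).
have d0 : 0 < d by rewrite lt_min ltr01 divr_gt0.
near=> p => t Dt.
have [d1 d2] : `|f1 p t - g1 t| <= d /\ `|f2 p t - g2 t| <= d.
  by split; move: t Dt; near: p; [exact: h1|exact: h2].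
have -> : f1 p t * f2 p t - g1 t * g2 t =
    (f1 p t - g1 t) * (f2 p t - g2 t)
    + g1 t * (f2 p t - g2 t) + g2 t * (f1 p t - g1 t) by ring.
apply: (@le_trans _ _ (d * d + `|G1| * d + `|G2| * d)).
  rewrite (le_trans (ler_normD _ _))// lerD//.
    rewrite (le_trans (ler_normD _ _))// lerD//.
      by rewrite normrM ler_pM.
    by rewrite normrM ler_pM// (le_trans (G1P t Dt))// ler_norm.
  by rewrite normrM ler_pM// (le_trans (G2P t Dt))// ler_norm.
apply: (@le_trans _ _ (d * K)).
  rewrite /K 2!mulrDr mulr1 lerD ?lerD//.
  - by rewrite ler_piMr ?(ltW d0)// /d ge_min lexx.
  - by rewrite mulrC.
  - by rewrite mulrC.
by rewrite -ler_pdivlMr// /d ge_min lexx orbT.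
Unshelve. all: by end_near. Qed.

Lemma bounded_ucvg_sum (I : Type) (r : seq I) (f : I -> P -> T -> R)
    (g : I -> T -> R) :
  (forall i, bounded_ucvg (f i) (g i)) ->
  bounded_ucvg (fun p t => \sum_(i <- r) f i p t) (fun t => \sum_(i <- r) g i t).
Proof.
move=> fg; elim: r => [|i r IH].
  rewrite [X in bounded_ucvg X _](_ : _ = fun=> cst 0); last first.
    by apply/funext => p; apply/funext => t; rewrite big_nil.
  rewrite [X in bounded_ucvg _ X](_ : _ = cst 0); last first.
    by apply/funext => t; rewrite big_nil.
  by apply: (@bounded_ucvg_fixed _ 0) => t _; rewrite normr0.
rewrite [X in bounded_ucvg X _](_ : _ =
    fun p t => f i p t + \sum_(j <- r) f j p t); last first.
  by apply/funext => p; apply/funext => t; rewrite big_cons.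
rewrite [X in bounded_ucvg _ X](_ : _ =
    fun t => g i t + \sum_(j <- r) g j t); last first.
  by apply/funext => t; rewrite big_cons.
exact: bounded_ucvgD.
Qed.

End UniformConvergence.

Lemma continuous_itv_integrable (R : realType) (a b : R) (f : R -> R) :
  {within `[a, b], continuous f} ->
  (@lebesgue_measure R).-integrable `[a, b] (EFin \o f).
Proof.
by move=> cf; apply: continuous_compact_integrable => //; exact: segment_compact.
Qed.

Lemma Rintegral_bounded_ucvg (R : realType) (T : R) (P : Type)
    (F : set_system P) (FF : Filter F) (f : P -> R -> R) (g : R -> R) :
  0 < T -> {within `[0, T], continuous g} ->
  (forall p, {within `[0, T], continuous (f p)}) ->
  bounded_ucvg `[0, T]%classic F f g ->
  \int[lebesgue_measure]_(t in `[0, T]) f p t @[p --> F] -->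
  \int[lebesgue_measure]_(t in `[0, T]) g t.
Proof.
move=> T0 cg cf [_ fg]; apply/cvgrPdist_le => e e0.
have eT0 : 0 < e / T by rewrite divr_gt0.
have := fg _ eT0; apply: filterS => p fp.
rewrite -RintegralB//; [|exact: continuous_itv_integrable..].
have cfg : {within `[0, T], continuous (fun t => g t - f p t)}.
  exact: within_continuousB.
apply: (le_trans (le_normr_Rintegral _ _)) => //.
  exact: continuous_itv_integrable.
apply: (@le_trans _ _ (\int[lebesgue_measure]_(t in `[0, T]) (cst (e / T) t))).
  apply: le_Rintegral => //.
  - apply: continuous_itv_integrable => s.
    by apply: cvg_norm; exact: cfg.
  - by apply: continuous_itv_integrable; apply: continuous_subspaceT => s; exact: cvg_cst.
  - by move=> t tT; rewrite distrC; exact: fp.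
rewrite Rintegral_cst//= lebesgue_measure_itv/= lte_fin T0/= oppr0 addr0 mulfVK//.
by rewrite gt_eqF.
Qed.

(** * Continuous dependence of the state on the data *)

Definition linear_ode_on (R : realType) (n : nat) (T : R) (A : 'M[R]_n)
    (b x : R -> 'cV[R]_n) : Prop :=
  (forall i, {within `[0, T], continuous (fun t => x t i 0)}) /\
  forall t : R, t \in `]0, T[ -> is_derive t 1 x (A *m x t + b t).

Lemma within_itv_bounded (R : realType) (a b : R) (f : R -> R) :
  {within `[a, b], continuous f} ->
  exists G, forall t, `[a, b]%classic t -> `|f t| <= G.
Proof.
move=> cf; have /compact_bounded := continuous_compact cf (@segment_compact _ a b).
move=> [G [_ /(_ (G + 1))]]; rewrite ltrDl ltr01 => /(_ isT) H.
by exists (G + 1) => t abt; apply: H; exists t.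
Qed.

Lemma within_itv_bounded_cV (R : realType) (n : nat) (a b : R)
    (f : R -> 'cV[R]_n) :
  (forall i, {within `[a, b], continuous (fun t => f t i 0)}) ->
  exists2 G, 0 <= G & forall t i, `[a, b]%classic t -> `|f t i 0| <= G.
Proof.
move=> cf.
have /choice[G GP] i := within_itv_bounded (cf i).
exists (\sum_i `|G i|); first exact: sumr_ge0.
move=> t i abt; rewrite (bigD1 i)//= (le_trans (GP i t abt))//.
by rewrite (le_trans (ler_norm _))// lerDl sumr_ge0.
Qed.

(** The difference of the two states solves an equation with matrix [A p] and residual
    [(A p - A0) *m x0 t + (B p - B0) *m u t]. Only the limit state enters the residual, so no bound
    on the states [x p] that is uniform in [p] has to be found first. *)
Lemma linear_ode_bounded_ucvg (R : realType) (n m : nat) (T : R) (P : Type)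
    (F : set_system P) (FF : Filter F) (u : R -> 'cV[R]_m)
    (A : P -> 'M[R]_n) (B : P -> 'M[R]_(n, m)) (x : P -> R -> 'cV[R]_n)
    (A0 : 'M[R]_n) (B0 : 'M[R]_(n, m)) (x0 : R -> 'cV[R]_n) :
  0 < T ->
  (forall i, {within `[0, T], continuous (fun t => u t i 0)}) ->
  (forall p, linear_ode_on T (A p) (fun t => B p *m u t) (x p)) ->
  linear_ode_on T A0 (fun t => B0 *m u t) x0 ->
  (forall i j, A p i j @[p --> F] --> A0 i j) ->
  (forall i j, B p i j @[p --> F] --> B0 i j) ->
  (forall i, x p 0 i 0 @[p --> F] --> x0 0 i 0) ->
  forall i, bounded_ucvg `[0, T]%classic F (fun p t => x p t i 0)
    (fun t => x0 t i 0).
Proof.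
move=> T0 cu xode [cx0 dx0] cA cB cx i.
have [X X0 XP] := within_itv_bounded_cV cx0.
have [U U0 UP] := within_itv_bounded_cV cu.
split; first by exists X => t Tt; exact: XP.
move=> e e0.
(* The added [1] lets [M] bound the entries of [A p] too, once these are within [d <= 1] of those of
   [A0]. *)
pose M := \sum_i \sum_j `|A0 i j| + 1.
have M0 : 0 <= M.
  by rewrite addr_ge0// sumr_ge0// => k _; rewrite sumr_ge0.
have A0M k j : `|A0 k j| <= M - 1.
  rewrite addrK (bigD1 k)//= (bigD1 j)//= -addrA lerDl addr_ge0//.
    exact: sumr_ge0.
  by apply: sumr_ge0 => l _; exact: sumr_ge0.
(* When all data errors are at most [d], the residual is at most [L * d] and the squared difference
   of the states at most [C * d ^+ 2]. *)
pose L := n%:R * X + m%:R * U.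
pose C := expR ((2 * n%:R * M + 1) * T) * (n%:R + n%:R * L ^+ 2 * T).
have C0 : 0 <= C.
  rewrite mulr_ge0 ?expR_ge0// addr_ge0// mulr_ge0 ?(ltW T0)//.
  by rewrite mulr_ge0 ?sqr_ge0.
(* Using [C + 1] keeps the divisor positive and avoids a square root: [C <= (C + 1) ^+ 2], hence [C
   * d ^+ 2 <= (d * (C + 1)) ^+ 2 <= e ^+ 2]. *)
pose d := Num.min 1 (e / (C + 1)).
have C10 : 0 < C + 1 by rewrite ltr_wpDl.
have d0 : 0 < d by rewrite lt_min ltr01 divr_gt0.
near=> p => t Tt.
have dA k j : `|A p k j - A0 k j| <= d.
  rewrite distrC; move: k j; near: p; apply: filter_forall => k.
  apply: filter_forall => j.
  by move/cvgrPdist_le : (cA k j); exact.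
have dB k j : `|B p k j - B0 k j| <= d.
  rewrite distrC; move: k j; near: p; apply: filter_forall => k.
  apply: filter_forall => j.
  by move/cvgrPdist_le : (cB k j); exact.
have dx k : `|x p 0 k 0 - x0 0 k 0| <= d.
  rewrite distrC; move: k; near: p; apply: filter_forall => k.
  by move/cvgrPdist_le : (cx k); exact.
have [cxp dxp] := xode p.
have APM k j : `|A p k j| <= M.
  rewrite -(subrK (A0 k j) (A p k j)) (le_trans (ler_normD _ _))//.
  rewrite addrC -(subrK 1 M) lerD// (le_trans (dA _ _))//.
  by rewrite /d ge_min lexx.
have d_ge0 := ltW d0.
have : `|x p t i 0 - x0 t i 0| ^+ 2 <= C * d ^+ 2.
  have -> : x p t i 0 - x0 t i 0 = (x p t - x0 t) i 0 by rewrite !mxE.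
  apply: (le_trans (@linear_ode_estimate R n (A p) (fun t => x p t - x0 t)
    (fun t => (A p - A0) *m x0 t + (B p - B0) *m u t)
    T M (L * d) M0 APM _ _ _ t i Tt)).
  - move=> k; rewrite (_ : (fun s => _) = fun s => x p s k 0 - x0 s k 0); last first.
      by apply/funext => s; rewrite !mxE.
    exact: within_continuousB.
  - move=> s sT; apply: is_derive_eq (is_deriveB (dxp s sT) (dx0 s sT)) _.
    rewrite mulmxBr !mulmxBl.
    by rewrite opprD addrACA [in RHS]addrA subrKA.
  - move=> s k sT; have sT' : `[0, T]%classic s by exact: subset_itv_oo_cc.
    rewrite !mxE (le_trans (ler_normD _ _))// /L mulrDl lerD//.
      rewrite (le_trans (ler_norm_sum _ _ _))//.
      apply: (@le_trans _ _ (\sum_(j < n) d * X)).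
        by apply: ler_sum => j _; rewrite !mxE normrM ler_pM// XP.
      by rewrite sumr_const card_ord -mulr_natl; lra.
    rewrite (le_trans (ler_norm_sum _ _ _))//.
    apply: (@le_trans _ _ (\sum_(j < m) d * U)).
      by apply: ler_sum => j _; rewrite !mxE normrM ler_pM// UP.
    by rewrite sumr_const card_ord -mulr_natl; lra.
  rewrite /C -[leRHS]mulrA ler_wpM2l ?expR_ge0// [leRHS]mulrDl lerD//.
    apply: (@le_trans _ _ (\sum_(j < n) d ^+ 2)).
      apply: ler_sum => j _; rewrite !mxE -real_normK ?num_real//.
      by rewrite lerXn2r// nnegrE.
    by rewrite sumr_const card_ord mulr_natl.
  by rewrite exprMn; lra.
move=> h; rewrite -(@ler_pXn2r _ 2)// ?nnegrE ?(ltW e0)//.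
apply: (le_trans h).
have : d * (C + 1) <= e by rewrite -ler_pdivlMr// /d ge_min lexx orbT.
move=> dC; apply: (@le_trans _ _ ((d * (C + 1)) ^+ 2)).
  rewrite exprMn mulrC ler_wpM2l ?sqr_ge0// sqrrD; nra.
by rewrite lerXn2r ?nnegrE ?mulr_ge0 ?(ltW d0) ?(ltW C10) ?(ltW e0).
Unshelve. all: by end_near. Qed.

(** * Compact boxes in the parameter space *)

Lemma cvg_mxP (R : realType) (p q : nat) (S : Type) (F : set_system S)
    (FF : Filter F) (f : S -> 'M[R]_(p, q)) (l : 'M[R]_(p, q)) :
  (forall i j, f s i j @[s --> F] --> l i j) <-> f s @[s --> F] --> l.
Proof.
split=> [fl|fl i j]; last first.
  apply: (@cvg_comp _ _ _ f (fun M : 'M[R]_(p, q) => M i j) _ _ _ fl).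
  exact: coord_continuous.
apply/cvgrPdist_le => e e0; near=> s.
rewrite /Num.Def.normr/= mx_normrE (bigmax_le _ (ltW e0))//= => -[i j] _.
rewrite !mxE/=; move: i j; near: s.
apply: filter_forall => i; apply: filter_forall => j.
by move/cvgrPdist_le : (fl i j); exact.
Unshelve. all: by end_near. Qed.

(** The box is the image under the continuous map [vec_mx] of a product of segments, compact by
    Tychonoff. *)
Lemma mx_box_compact (R : realType) (p q : nat) (M : R) :
  compact [set A : 'M[R]_(p, q) | forall i j, `|A i j| <= M].
Proof.
have cbox := @rV_compact R (p * q) (fun=> `[- M, M]%classic)
  (fun=> @segment_compact _ _ _).
rewrite (_ : mkset _ = vec_mx @`
    [set v : 'rV[R]_(p * q) | forall k, `[- M, M]%classic (v ord0 k)]); last first.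
  apply/seteqP; split=> [A AM|_ [v vM <-] i j] /=.
    exists (mxvec A); last exact: mxvecK.
    move=> k /=; case/mxvec_indexP: k => i j.
    by rewrite mxvecE in_itv/= -ler_norml.
  by rewrite mxE ler_norml; have := vM (mxvec_index i j); rewrite /= in_itv.
apply: continuous_compact cbox; apply: continuous_subspaceT => v.
apply: (cvg_mxP (nbhs_filter v) (@vec_mx R p q) _).1 => i j.
rewrite mxE (_ : (fun s => _) = fun s : 'rV[R]_(p * q) => s 0 (mxvec_index i j)).
  exact: coord_continuous.
by apply/funext => s; rewrite mxE.
Qed.

Definition param_entries_le (R : realType) (n m : nat) (M : R) :
    set (param R n m) :=
  [set w : param R n m | let: (J, D, Q, B, x0) := w in
    [/\ forall i j, `|J i j| <= M, forall i j, `|D i j| <= M,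
      forall i j, `|Q i j| <= M, forall i j, `|B i j| <= M
      & forall i j, `|x0 i j| <= M]].

Lemma param_entries_le_compact (R : realType) (n m : nat) (M : R) :
  compact (@param_entries_le R n m M).
Proof.
have h := compact_setX (compact_setX (compact_setX (compact_setX
  (@mx_box_compact R n n M) (@mx_box_compact R n n M))
  (@mx_box_compact R n n M)) (@mx_box_compact R n m M))
  (@mx_box_compact R n 1 M).
refine (eq_ind _ compact h _ _); apply/seteqP.
by split=> [[[[[J D] Q] B] x0] [[[[]]]]|[[[[J D] Q] B] x0] []].
Qed.

Lemma euclidean_norm_ge (R : realType) (p q : nat) (A : 'M[R]_(p, q)) i j :
  `|A i j| <= euclidean_norm A.
Proof.
rewrite /euclidean_norm -sqrtr_sqr ler_wsqrtr// (bigD1 i)//= (bigD1 j)//=.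
rewrite -addrA lerDl addr_ge0//; first by apply: sumr_ge0 => k _; exact: sqr_ge0.
by apply: sumr_ge0 => k _; apply: sumr_ge0 => l _; exact: sqr_ge0.
Qed.

Lemma param_norm_entries (R : realType) (n m : nat) (w : param R n m) (M : R) :
  param_norm w <= M -> param_entries_le M w.
Proof.
case: w => -[[[J D] Q] B] x0 /= wM.
have le_norm (a b : R) : 0 <= a -> a ^+ 2 <= b -> a <= Num.sqrt b.
  by move=> a0 ab; rewrite -(ger0_norm a0) -sqrtr_sqr ler_wsqrtr.
have e2 p q (A : 'M[R]_(p, q)) : 0 <= euclidean_norm A ^+ 2 by exact: sqr_ge0.
have e1 p q (A : 'M[R]_(p, q)) : 0 <= euclidean_norm A by exact: sqrtr_ge0.
split=> i j; apply: le_trans wM;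
  apply: (le_trans (euclidean_norm_ge _ _ _)); apply: le_norm => //;
  move: (e2 _ _ J) (e2 _ _ D) (e2 _ _ Q) (e2 _ _ B) (e2 _ _ x0); lra.
Qed.

Lemma param_entries_leD (R : realType) (n m : nat) (w v : param R n m) (M N : R) :
  param_entries_le M (w - v) -> param_entries_le N v ->
  param_entries_le (M + N) w.
Proof.
case: w => -[[[J D] Q] B] x0; case: v => -[[[J' D'] Q'] B'] x0'.
move=> [/= h1 h2 h3 h4 h5] [/= k1 k2 k3 k4 k5].
have tri p q (A A' : 'M[R]_(p, q)) i j : `|(A - A') i j| <= M ->
    `|A' i j| <= N -> `|A i j| <= M + N.
  rewrite !mxE => a b; rewrite -(subrK (A' i j) (A i j)).
  by rewrite (le_trans (ler_normD _ _))// lerD.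
split=> i j /=; exact: tri.
Qed.

(** * Weak derivatives and outputs that agree almost everywhere *)

Lemma within_continuous_measurable_oo (R : realType) (a b : R) (f : R -> R) :
  {within `[a, b], continuous f} -> measurable_fun `]a, b[ f.
Proof.
move=> cf; apply: subspace_continuous_measurable_fun => //.
exact: continuous_subspaceW (@subset_itv_oo_cc _ _ a b) cf.
Qed.

Lemma continuous_square_integrable (R : realType) (T : R) (f : R -> R) :
  {within `[0, T], continuous f} -> square_integrable T f.
Proof.
move=> cf; split; first exact: within_continuous_measurable_oo.
have : (@lebesgue_measure R).-integrable `[0, T] (EFin \o (fun t => f t ^+ 2)).
  apply: continuous_itv_integrable => t; rewrite /=.
  by apply: cvgM; exact: cf.
by apply: integrableS => //; exact: subset_itv_oo_cc.
Qed.

Lemma test_function_continuous (R : realType) (T : R) (phi : R -> R) :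
  test_function T phi -> continuous phi /\ continuous (derive1 phi).
Proof.
move=> [dphi _ _]; split=> t.
  exact/differentiable_continuous/derivable1_diffP/(dphi 0%N).
exact/differentiable_continuous/derivable1_diffP/(dphi 1%N).
Qed.

Lemma test_function_boundary (R : realType) (T : R) (phi : R -> R) :
  test_function T phi -> phi 0 = 0 /\ phi T = 0.
Proof.
move=> [_ _ supp].
have out (t : R) : ~ `]0, T[%classic t -> phi t = 0.
  move=> tT; apply/eqP; apply: contrapT => /negP phit.
  by apply/tT/supp/subset_closure.
by split; apply: out; rewrite /= in_itv/= ltxx// andbF.
Qed.

(** Integration by parts on [[0, T]], which differs from []0, T[] by a null set. The boundary terms
    vanish because the closed support of a test function lies in the open interval. *)
Lemma weak_derivative_C1 (R : realType) (T : R) (f g : R -> R) :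
  0 < T -> {in `]0, T[, forall t : R, is_derive t 1 f (g t)} ->
  f t @[t --> 0^'+] --> f 0 -> f t @[t --> T^'-] --> f T ->
  {within `[0, T], continuous g} -> weak_derivative T f g.
Proof.
move=> T0 df f0 fT cg phi tphi.
have [cphi cdphi] := test_function_continuous tphi.
have [phi0 phiT] := test_function_boundary tphi.
have [dphi _ _] := tphi.
have fLR : derivable_oo_LRcontinuous f 0 T by split=> // t /df [].
have cf := derivable_oo_LRcontinuous_within fLR.
have pLR : derivable_oo_LRcontinuous phi 0 T.
  split=> [t _| |]; first exact: (dphi 0%N t).
    by apply: cvg_at_right_filter; exact: cphi.
  by apply: cvg_at_left_filter; exact: cphi.
have intS (h : R -> R) : {within `[0, T], continuous h} ->
    \int[lebesgue_measure]_(t in `]0, T[) h t =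
    \int[lebesgue_measure]_(t in `[0, T]) h t.
  move=> /continuous_itv_integrable ih.
  rewrite Rintegral_itv_bndo_bndc ?Rintegral_itv_obnd_cbnd//.
    by apply: integrableS ih => //; exact: subset_itv_oc_cc.
  by apply: integrableS ih => //; exact: subset_itv_oo_cc.
rewrite !intS.
- rewrite (@Rintegration_by_parts _ f phi g (derive1 phi))//.
  + by rewrite phi0 phiT !mulr0 subrr sub0r.
  + by move=> t /df [_ <-]; rewrite derive1E.
  + exact: continuous_subspaceT.
- move=> t; apply: cvgM; first exact: cg.
  by move: t; apply: continuous_subspaceT.
- move=> t; apply: cvgM; first exact: cf.
  by move: t; apply: continuous_subspaceT.
Qed.

Lemma euclidean_norm_sqr (R : realType) (m : nat) (v : 'cV[R]_m) :
  euclidean_norm v ^+ 2 = \sum_i v i 0 ^+ 2.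
Proof.
rewrite /euclidean_norm sqr_sqrtr; last first.
  by apply: sumr_ge0 => i _; apply: sumr_ge0 => j _; exact: sqr_ge0.
by apply: eq_bigr => i _; rewrite big_ord_recl big_ord0 addr0.
Qed.

(** The output [y] is controlled only on the open interval, so both integrals are moved there before
    the integrands are compared. *)
Lemma eq_ae_misfit (R : realType) (m : nat) (T : R) (y z d : R -> 'cV[R]_m) :
  (forall i, measurable_fun `]0, T[ (fun t => y t i 0)) ->
  (forall i, {within `[0, T], continuous (fun t => z t i 0)}) ->
  (forall i, {within `[0, T], continuous (fun t => d t i 0)}) ->
  {ae @lebesgue_measure R, forall t, t \in `]0, T[ -> y t = z t} ->
  \int[lebesgue_measure]_(t in `[0, T]) (euclidean_norm (y t - d t) ^+ 2) =
  \int[lebesgue_measure]_(t in `[0, T]) (euclidean_norm (z t - d t) ^+ 2).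
Proof.
move=> my cz cd yz.
have mdist (v : R -> 'cV[R]_m) :
    (forall i, measurable_fun `]0, T[ (fun t => v t i 0)) ->
    measurable_fun `]0, T[ (fun t => euclidean_norm (v t - d t) ^+ 2).
  move=> mv; rewrite [X in measurable_fun _ X](_ : _ =
      fun t => \sum_i (v t i 0 - d t i 0) ^+ 2); last first.
    apply/funext => t; rewrite euclidean_norm_sqr; apply: eq_bigr => i _.
    by rewrite !mxE.
  apply: measurable_sum => i; apply: measurable_funX; apply: measurable_funB.
    exact: mv.
  exact: within_continuous_measurable_oo.
have mY := mdist y my.
have mZ := mdist z (fun i => within_continuous_measurable_oo (cz i)).
rewrite /Rintegral; congr fine.
have intS (h : R -> R) : measurable_fun `]0, T[ h ->
    (\int[lebesgue_measure]_(t in `[0%R, T]) (h t)%:E =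
     \int[lebesgue_measure]_(t in `]0%R, T[) (h t)%:E)%E.
  move=> mh; rewrite [RHS]integral_itv_obnd_cbnd; last exact/measurable_EFinP.
  rewrite integral_itv_bndo_bndc//; apply/measurable_EFinP.
  exact: measurable_fun_itv_co mh.
rewrite !intS//; apply: ae_eq_integral => //; try exact/measurable_EFinP.
apply: (@filterS _ (almost_everywhere lebesgue_measure) _ _ _ _ yz) => t yzt tT.
by rewrite /= yzt// inE.
Qed.

(** * Extension of the input and uniqueness of the state *)

Lemma continuous_clamp (R : realType) (T : R) (f : R -> R) :
  0 < T -> {within `[0, T], continuous f} ->
  continuous (fun t => f (Num.max 0 (Num.min t T))).
Proof.
move=> T0 /subspace_continuousP cf t.
(* The clamp retracts the line onto [[0, T]], so composing with it turns continuity within the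
   segment into continuity everywhere. *)
have clampT (s : R) : `[0, T]%classic (Num.max 0 (Num.min s T)).
  by rewrite /= in_itv/= le_max lexx/= ge_max ltW//= ge_min lexx orbT.
have cclamp : continuous (fun s : R => Num.max 0 (Num.min s T)).
  have cmin : continuous ((id : R -> R) \min cst T).
    by move=> s; apply: continuous_min; [exact: cvg_id|exact: cvg_cst].
  move=> s; exact: (@continuous_max R R (cst 0) _ s (@cvg_cst _ _ _ _ _) (cmin s)).
apply: (@cvg_comp _ _ _ (fun s : R => Num.max 0 (Num.min s T)) f _ _ _ _
  (cf _ (clampT t))).
move=> A /(cclamp t).
by apply: (@filterS _ (nbhs t)) => s; apply; exact: clampT.
Qed.

Lemma clamp_id (R : realType) (T t : R) :
  t \in `[0, T] -> Num.max 0 (Num.min t T) = t.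
Proof. by rewrite in_itv/= => /andP[t0 tT]; rewrite min_l// max_r. Qed.

(** Uniqueness as a degenerate case of stability: the constant family [x] has the data of [y], hence
    converges uniformly to [y], and is therefore within every [e] of it. The filter [nbhs true]
    merely offers a point at which to evaluate. *)
Lemma linear_ode_unique (R : realType) (n m : nat) (T : R) (A : 'M[R]_n)
    (B : 'M[R]_(n, m)) (u : R -> 'cV[R]_m) (x y : R -> 'cV[R]_n) :
  0 < T ->
  (forall i, {within `[0, T], continuous (fun t => u t i 0)}) ->
  linear_ode_on T A (fun t => B *m u t) x ->
  linear_ode_on T A (fun t => B *m u t) y ->
  x 0 = y 0 -> forall t, t \in `[0, T] -> x t = y t.
Proof.
move=> T0 cu ox oy xy0 t tT; apply/matrixP => i j; rewrite ord1.
have [_ h] : bounded_ucvg `[0, T]%classic (nbhs true)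
    (fun=> fun t => x t i 0) (fun t => y t i 0).
  apply: (@linear_ode_bounded_ucvg R n m T bool (nbhs true) _ u (fun=> A) (fun=> B)
    (fun=> x) A B y) => // *; rewrite ?xy0; exact: cvg_cst.
apply/eqP; rewrite -subr_eq0 -normr_le0; apply/ler_addgt0Pl => e e0.
by rewrite addr0; have /nbhs_singleton/(_ t tT) := h e e0.
Qed.

(** * Continuity of projections, products and squared norms *)

Lemma param_projections_cvg (R : realType) (n m : nat) (w : param R n m) :
  [/\ (fun v : param R n m => v.1.1.1.1) @ w --> w.1.1.1.1,
    (fun v : param R n m => v.1.1.1.2) @ w --> w.1.1.1.2,
    (fun v : param R n m => v.1.1.2) @ w --> w.1.1.2,
    (fun v : param R n m => v.1.2) @ w --> w.1.2
  & (fun v : param R n m => v.2) @ w --> w.2].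
Proof.
have cfst (U V : topologicalType) (S : Type) (F : set_system S) (FF : Filter F)
    (f : S -> U * V) (l : U * V) : f s @[s --> F] --> l ->
    (f s).1 @[s --> F] --> l.1 /\ (f s).2 @[s --> F] --> l.2.
  move=> fl; split.
    by apply: (cvg_comp _ _ fl); exact: cvg_fst.
  by apply: (cvg_comp _ _ fl); exact: cvg_snd.
have [h1 h5] := cfst _ _ _ _ _ (fun v : param R n m => v) w (@cvg_id _ (nbhs w)).
have [h2 h4] := cfst _ _ _ _ _ _ _ h1.
have [h3 h6] := cfst _ _ _ _ _ _ _ h2.
have [h7 h8] := cfst _ _ _ _ _ _ _ h3.
by split.
Qed.

Lemma cvg_mulmx (R : realType) (p q r : nat) (S : Type) (F : set_system S)
    (FF : Filter F) (f : S -> 'M[R]_(p, q)) (g : S -> 'M[R]_(q, r))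
    (a : 'M[R]_(p, q)) (b : 'M[R]_(q, r)) :
  f @ F --> a -> g @ F --> b -> f s *m g s @[s --> F] --> a *m b.
Proof.
move=> /cvg_mxP fa /cvg_mxP gb; apply/cvg_mxP => i j; rewrite mxE.
rewrite (_ : (fun s => _) = fun s => \sum_k f s i k * g s k j); last first.
  by apply/funext => s; rewrite mxE.
by apply: cvg_sumr => k; apply: cvgM; [exact: fa|exact: gb].
Qed.

Lemma mulmx_within_continuous (R : realType) (p q : nat) (D : set R)
    (A : 'M[R]_(p, q)) (v : R -> 'cV[R]_q) :
  (forall k, {within D, continuous (fun t => v t k 0)}) ->
  forall k, {within D, continuous (fun t => (A *m v t) k 0)}.
Proof.
move=> cv k; rewrite (_ : (fun t => _) = fun t => \sum_j A k j * v t j 0).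
  by move=> t; apply: cvg_sumr => j; apply: cvgM; [exact: cvg_cst|exact: cv].
by apply/funext => t; rewrite mxE.
Qed.

Lemma cvg_trmx (R : realType) (p q : nat) (S : Type) (F : set_system S)
    (FF : Filter F) (f : S -> 'M[R]_(p, q))
    (a : 'M[R]_(p, q)) :
  f @ F --> a -> (f s)^T @[s --> F] --> a^T.
Proof.
move=> /cvg_mxP fa; apply/cvg_mxP => i j; rewrite mxE.
rewrite (_ : (fun s => _) = fun s => f s j i); first exact: fa.
by apply/funext => s; rewrite mxE.
Qed.

Lemma cvg_euclidean_norm_sqr (R : realType) (p q : nat) (S : Type)
    (F : set_system S) (FF : Filter F) (f : S -> 'M[R]_(p, q))
    (a : 'M[R]_(p, q)) :
  f @ F --> a -> euclidean_norm (f s) ^+ 2 @[s --> F] --> euclidean_norm a ^+ 2.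
Proof.
have sqE (A : 'M[R]_(p, q)) :
    euclidean_norm A ^+ 2 = \sum_i \sum_j A i j * A i j.
  rewrite /euclidean_norm sqr_sqrtr//.
  by apply: sumr_ge0 => i _; apply: sumr_ge0 => j _; exact: sqr_ge0.
move=> /cvg_mxP fa; rewrite sqE.
rewrite (_ : (fun s => _) = fun s => \sum_i \sum_j f s i j * f s i j); last first.
  by apply/funext => s; rewrite sqE.
apply: cvg_sumr => i; apply: cvg_sumr => j.
by apply: cvgM; exact: fa.
Qed.

(** * The canonical state and output of a parameter *)

Section ReducedProblem.
Variables (R : realType) (n m : nat) (T : R).
Implicit Types (w : param R n m) (u : R -> 'cV[R]_m).

Definition state_mx w : 'M[R]_n := (w.1.1.1.1 - w.1.1.1.2) *m w.1.1.2.
Definition output_mx w : 'M[R]_(m, n) := w.1.2^T *m w.1.1.2.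

Lemma state_mx_cvg w : state_mx v @[v --> w] --> state_mx w.
Proof.
have [hJ hD hQ _ _] := param_projections_cvg w.
by apply: cvg_mulmx hQ; exact: cvgB.
Qed.

Lemma output_mx_cvg w : output_mx v @[v --> w] --> output_mx w.
Proof.
have [_ _ hQ hB _] := param_projections_cvg w.
by apply: cvg_mulmx hQ; exact: cvg_trmx.
Qed.

Lemma param_norm_sqr_continuous (wref : param R n m) :
  continuous (fun w => param_norm (w - wref) ^+ 2).
Proof.
pose q p r (A : 'M[R]_(p, r)) := euclidean_norm A ^+ 2.
have sqE (w : param R n m) : param_norm w ^+ 2 = q _ _ w.1.1.1.1 + q _ _ w.1.1.1.2
    + q _ _ w.1.1.2 + q _ _ w.1.2 + q _ _ w.2.
  case: w => -[[[J D] Q] B] x0; rewrite /param_norm sqr_sqrtr//.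
  by rewrite !addr_ge0// sqr_ge0.
move=> w; have [hJ hD hQ hB hx] := param_projections_cvg w.
rewrite /continuous_at sqE (_ : (fun v => _) = fun v : param R n m =>
    q _ _ (v.1.1.1.1 - wref.1.1.1.1) + q _ _ (v.1.1.1.2 - wref.1.1.1.2)
    + q _ _ (v.1.1.2 - wref.1.1.2) + q _ _ (v.1.2 - wref.1.2)
    + q _ _ (v.2 - wref.2)); last by apply/funext => v; rewrite sqE.
by do 4?[apply: cvgD]; apply: cvg_euclidean_norm_sqr; apply: cvgB => //;
  exact: cvg_cst.
Qed.

Hypothesis T_gt0 : 0 < T.

Lemma within_coord p (f : R -> 'cV[R]_p) : {within `[0, T], continuous f} ->
  forall i, {within `[0, T], continuous (fun t => f t i 0)}.
Proof. by move=> cf i t; have /cvg_mxP := cf t; exact. Qed.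

Lemma state_solution_linear_ode u w x : state_solution T u w x ->
  linear_ode_on T (state_mx w) (fun t => w.1.2 *m u t) x /\ x 0 = w.2.
Proof.
case: w => -[[[J D] Q] B] x0 [cx dx x00]; split=> //; split=> //.
exact: within_coord.
Qed.

(* Holding on ]-1, +oo[ rather than on ]0, T[, with the input clamped to
   [0, T], makes continuity at the end points automatic. *)
Definition global_state u w (x : R -> 'cV[R]_n) : Prop :=
  x 0 = w.2 /\ forall t : R, - 1 < t -> is_derive t 1 x
    (state_mx w *m x t + w.1.2 *m u (Num.max 0 (Num.min t T))).

Lemma global_state_exists u w : {within `[0, T], continuous u} ->
  exists x, global_state u w x.
Proof.
move=> cu; have [i|x x0 dx] := @linear_ode_solution R n (state_mx w)
  (fun t => w.1.2 *m u (Num.max 0 (Num.min t T))) w.2; last by exists x.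
rewrite (_ : (fun t => _) = fun t =>
    \sum_j w.1.2 i j * u (Num.max 0 (Num.min t T)) j 0); last first.
  by apply/funext => t; rewrite mxE.
move=> t; apply: cvg_sumr => j; apply: cvgM; first exact: cvg_cst.
exact: (continuous_clamp T_gt0 (@within_coord _ _ cu j)).
Qed.

Lemma itv_gtN1 (t : R) : `[0, T]%classic t -> - 1 < t.
Proof. by rewrite /= in_itv/= => /andP[t0 _]; rewrite (lt_le_trans _ t0). Qed.

Lemma global_state_continuous u w x : global_state u w x ->
  forall t : R, - 1 < t -> {for t, continuous x}.
Proof.
move=> [_ dx] t t1; apply/cvg_mxP => i j.
by have /is_derive_mxP/(_ i j)/is_derive_continuous := dx t t1.
Qed.

Lemma global_state_solution u w x : global_state u w x -> state_solution T u w x.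
Proof.
move=> gx; have cx := global_state_continuous gx; move: gx.
case: w => -[[[J D] Q] B] x0 [/= x00 dx]; split=> //.
  rewrite continuous_subspace_in => t; rewrite inE => tT.
  apply: continuous_subspaceT_for => //; exact/cx/itv_gtN1.
move=> t tT; have tT' : `[0, T]%classic t by exact: subset_itv_oo_cc.
by have := dx t (itv_gtN1 tT'); rewrite clamp_id.
Qed.

Lemma global_output_sobolev u w x : {within `[0, T], continuous u} ->
  global_state u w x -> sobolev_H1 T (fun t => output_mx w *m x t).
Proof.
move=> cu gx i; have cx := global_state_continuous gx.
have [[cxi _] _] := state_solution_linear_ode (global_state_solution gx).
(* With the clamped input this is the derivative of [x] at the end points as well, so the output is
   continuously differentiable up to the boundary and its classical derivative is the weak one. *)
pose dx t := state_mx w *m x t + w.1.2 *m u (Num.max 0 (Num.min t T)).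
have cdx k : {within `[0, T], continuous (fun t => dx t k 0)}.
  rewrite (_ : (fun t => _) = fun t => (state_mx w *m x t) k 0 +
      (w.1.2 *m u (Num.max 0 (Num.min t T))) k 0); last first.
    by apply/funext => t; rewrite mxE.
  apply: within_continuousD; first exact: mulmx_within_continuous.
  apply: mulmx_within_continuous => l; apply: continuous_subspaceT.
  exact: (continuous_clamp T_gt0 (@within_coord _ _ cu l)).
have dy (t : R) : - 1 < t -> is_derive t 1 (fun s => (output_mx w *m x s) i 0)
    ((output_mx w *m dx t) i 0).
  move=> t1; have dxt := gx.2 t t1.
  have /is_derive_mxP/(_ i 0) := is_derive_mulmx (is_derive_cst (output_mx w) t 1) dxt.
  by rewrite mul0mx add0r.
split; first by apply: continuous_square_integrable; exact: mulmx_within_continuous.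
exists (fun t => (output_mx w *m dx t) i 0).
  by apply: continuous_square_integrable; exact: mulmx_within_continuous.
apply: weak_derivative_C1 => //.
- move=> t tT; apply/dy/itv_gtN1; exact: subset_itv_oo_cc.
- by apply: cvg_at_right_filter; apply: is_derive_continuous (dy _ _).
- apply: cvg_at_left_filter; apply: is_derive_continuous (dy _ _).
  by rewrite (lt_trans _ T_gt0).
- exact: mulmx_within_continuous.
Qed.

End ReducedProblem.

(** * The cost as a function of the parameter *)

Section CostContinuity.
Variables (R : realType) (n m : nat) (T : R) (u ydata : R -> 'cV[R]_m).
Hypothesis T_gt0 : 0 < T.
Hypothesis u_cont : {within `[0, T], continuous u}.
Hypothesis ydata_cont : {within `[0, T], continuous ydata}.
Implicit Types (w : param R n m) (x : R -> 'cV[R]_n).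

Let output w x t : 'cV[R]_m := output_mx w *m x t.

Let output_continuous w x : global_state T u w x ->
  forall i, {within `[0, T], continuous (fun t => output w x t i 0)}.
Proof.
move=> gx; apply: mulmx_within_continuous.
by have [[]] := state_solution_linear_ode (global_state_solution gx).
Qed.

(** Stability makes [X v] tend to [X w] uniformly on [[0, T]] as [v] tends to [w]. The integrand is
    a polynomial in entries of [output_mx v], [X v] and [ydata], so it converges uniformly too. *)
Lemma misfit_continuous (X : param R n m -> R -> 'cV[R]_n) :
  (forall w, global_state T u w (X w)) ->
  continuous (fun w => \int[lebesgue_measure]_(t in `[0, T])
    (euclidean_norm (output_mx w *m X w t - ydata t) ^+ 2)).
Proof.
move=> gX w.
pose f v t := euclidean_norm (output v (X v) t - ydata t) ^+ 2.
have fE v : f v = fun t => \sum_i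
    (output v (X v) t i 0 - ydata t i 0) * (output v (X v) t i 0 - ydata t i 0).
  apply/funext => t; rewrite /f euclidean_norm_sqr; apply: eq_bigr => i _.
  by rewrite !mxE.
have cf v : {within `[0, T], continuous (f v)}.
  rewrite fE => t; apply: cvg_sumr => i.
  have h : {within `[0, T], continuous
      (fun t => output v (X v) t i 0 - ydata t i 0)}.
    apply: within_continuousB; first exact: output_continuous.
    exact: (@within_coord _ _ _ _ ydata_cont).
  by apply: cvgM; exact: h.
apply: (@Rintegral_bounded_ucvg _ T _ (nbhs w) _ f (f w)) => //.
have ode v := state_solution_linear_ode (global_state_solution (gX v)).
have [_ _ _ hB hx] := param_projections_cvg w.
have ucX : forall i, bounded_ucvg `[0, T]%classic (nbhs w)
    (fun v t => X v t i 0) (fun t => X w t i 0).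
  apply: (@linear_ode_bounded_ucvg _ _ _ T _ (nbhs w) _ u (@state_mx _ _ _)
    (fun v => v.1.2) X (state_mx w) w.1.2 (X w)) => //.
  - exact: within_coord.
  - by move=> v; have [] := ode v.
  - by have [] := ode w.
  - by apply/cvg_mxP; exact: state_mx_cvg.
  - exact/cvg_mxP.
  - move=> i; rewrite (ode w).2 (_ : (fun v => _) = fun v : param R n m => v.2 i 0); last first.
      by apply/funext => v; rewrite (ode v).2.
    by move/cvg_mxP : hx; exact.
rewrite (_ : f = fun v t => \sum_i
    (output v (X v) t i 0 - ydata t i 0) *
    (output v (X v) t i 0 - ydata t i 0)); last first.
  by apply/funext => v; rewrite fE.
apply: bounded_ucvg_sum => i.
have h : bounded_ucvg `[0, T]%classic (nbhs w)
    (fun v t => output v (X v) t i 0 - ydata t i 0)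
    (fun t => output w (X w) t i 0 - ydata t i 0).
  apply: bounded_ucvgD; last first.
    have [G GP] := within_itv_bounded (@within_coord _ _ _ _ ydata_cont i).
    by apply: (@bounded_ucvg_fixed _ _ _ _ _ _ _ G) => t tT; rewrite normrN; exact: GP.
  rewrite [X in bounded_ucvg _ _ X _](_ : _ =
      fun v t => \sum_j output_mx v i j * X v t j 0); last first.
    by apply/funext => v; apply/funext => t; rewrite /output mxE.
  rewrite [X in bounded_ucvg _ _ _ X](_ : _ =
      fun t => \sum_j output_mx w i j * X w t j 0); last first.
    by apply/funext => t; rewrite /output mxE.
  apply: bounded_ucvg_sum => j; apply: bounded_ucvgM; last exact: ucX.
  apply: bounded_ucvg_scalar.
  by have /cvg_mxP := @output_mx_cvg R n m w; exact.
exact: bounded_ucvgM.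
Qed.

(** By uniqueness, the state witnessing feasibility agrees with the canonical one on [[0, T]]. The
    two outputs then agree almost everywhere, and the penalty depends on [w] alone. *)
Lemma cost_feasible (Uad : set (param R n m)) wref lambda y w x :
  global_state T u w x -> feasible T Uad u (y, w) ->
  cost T ydata wref lambda (y, w) =
  cost T ydata wref lambda (fun t => output_mx w *m x t, w).
Proof.
move=> gx [sy _ [x' sx' oy]]; rewrite /cost /=; congr (_ * _ + _).
have [ode x0] := state_solution_linear_ode (global_state_solution gx).
have [ode' x'0] := state_solution_linear_ode sx'.
have x'x t : t \in `[0, T] -> x' t = x t.
  apply: (linear_ode_unique T_gt0 _ ode' ode); first exact: within_coord.
  by rewrite x'0.
apply: eq_ae_misfit.
- by move=> i; have [[]] := sy i.
- exact: output_continuous.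
- exact: within_coord.
move: oy sx' => /=; case: (w) => -[[[J D] Q] B] z oy _.
apply: (@filterS _ (almost_everywhere lebesgue_measure) _ _ _ _ oy) => t yt tT.
by rewrite yt// x'x//; exact: subset_itv_oo_cc.
Qed.

Lemma global_output_feasible (Uad : set (param R n m)) w x :
  Uad w -> global_state T u w x ->
  feasible T Uad u (fun t => output_mx w *m x t, w).
Proof.
move=> Uw gx; split=> //; first exact: global_output_sobolev gx.
exists x; first exact: global_state_solution.
rewrite /= /output_equation; case: (w) => -[[[J D] Q] B] z.
exact: nearW.
Qed.

End CostContinuity.

(** * Minimization over a compact set of parameters *)

Theorem theorem4 (R : realType) (n m : nat) (T : R) (T_gt0 : 0 < T)
    (Uad : set (param R n m))
    (Uad_structured : Uad `<=` @structured R n m)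
    (Uad_nonempty : Uad !=set0)
    (Uad_closed : closed Uad)
    (u ydata : R -> 'cV[R]_m)
    (u_cont : {within `[0, T], continuous u})
    (ydata_cont : {within `[0, T], continuous ydata})
    (wref : param R n m) (lambda : R) (lambda_ge0 : 0 <= lambda)
    (coercive : 0 < lambda \/
      exists M : R, forall w : param R n m, Uad w -> param_norm w <= M) :
  exists2 yw : (R -> 'cV[R]_m) * param R n m, feasible T Uad u yw
    & forall yw' : (R -> 'cV[R]_m) * param R n m, feasible T Uad u yw' ->
        cost T ydata wref lambda yw <= cost T ydata wref lambda yw'.
Proof.
have /choice[X gX] := fun w : param R n m =>
  global_state_exists T_gt0 w u_cont.
pose c (w : param R n m) :=
  cost T ydata wref lambda (fun t => output_mx w *m X w t, w).
have c_cont : continuous c.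
  move=> w; apply: cvgD; apply: cvgMl_tmp.
    exact: (misfit_continuous T_gt0 u_cont ydata_cont gX).
  exact: param_norm_sqr_continuous.
have [w1 Uw1] := Uad_nonempty.
have [M sublevel] : exists M, forall w, Uad w -> c w <= c w1 ->
    param_entries_le M w.
  have [l0|[M HM]] := coercive; last first.
    by exists M => w Uw _; apply: param_norm_entries; exact: HM.
  (* If [param_norm (w - wref)] exceeds [N >= 1], so does its square, and the penalty exceeds
     [lambda / 2 * N = lambda / 2 + |c w1|], hence also [c w1]. The misfit is nonnegative, so [w]
     lies outside the sublevel set. *)
  pose N := 1 + 2 * `|c w1| / lambda.
  have N1 : 1 <= N by rewrite lerDl !mulr_ge0// invr_ge0.
  exists (N + param_norm wref) => w Uw cw.
  apply: (@param_entries_leD _ _ _ w wref); last exact: param_norm_entries.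
  apply: param_norm_entries; rewrite leNgt; apply/negP => Nw.
  have : lambda / 2 * N < c w1.
    apply: (lt_le_trans _ cw).
    apply: (@lt_le_trans _ _ (lambda / 2 * param_norm (w - wref) ^+ 2)).
      rewrite ltr_pM2l ?divr_gt0// (lt_le_trans Nw)// expr2 ler_peMl//.
        by rewrite (le_trans _ (ltW Nw))// (le_trans ler01).
      exact: le_trans N1 (ltW Nw).
    rewrite /c /cost /= lerDr mulr_ge0// Rintegral_ge0// => t _.
    exact: sqr_ge0.
  have -> : lambda / 2 * N = lambda / 2 + `|c w1|.
    by rewrite /N; field; rewrite gt_eqF.
  have := ler_norm (c w1); lra.
have K_compact : compact (param_entries_le M `&` Uad).
  by apply: compact_closedI => //; exact: param_entries_le_compact.
have Kw1 : (param_entries_le M `&` Uad) w1 by split=> //; exact: sublevel.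
have [|w0 + w0min] := compact_EVT_min _ K_compact (continuous_subspaceT c_cont).
  by exists w1.
rewrite inE => -[w0M Uw0].
exists (fun t => output_mx w0 *m X w0 t, w0).
  exact: (global_output_feasible T_gt0 u_cont Uw0 (gX w0)).
move=> [y w] yw; rewrite (cost_feasible T_gt0 u_cont ydata_cont _ _ (gX w) yw).
have Uw : Uad w by case: yw.
(* A parameter in the sublevel set of [w1] lies in the compact set; any other one is beaten by [w1],
   which lies in it. *)
have [cw|/ltW cw] := leP (c w) (c w1).
  by apply: w0min; rewrite inE; split=> //; exact: sublevel.
by apply: (le_trans (w0min w1 _) cw); rewrite inE.
Qed.
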